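(* For $i=1,2$ let $M_i\subseteq\mathcal B(H_i)$ and $N_i\subseteq\mathcal B(K_i)$ be von Neumann algebras, let $V\subseteq\mathcal B(H_1,K_1)$ be a quantum relation from $M_1$ to $N_1$, and let $\theta_M\colon M_1\to M_2$ and $\theta_N\colon N_1\to N_2$ be normal completely positive maps. Let $\overleftarrow{V}\subseteq\mathcal B(H_2,K_2)$ be the pullback of $V$ along $\theta_M\oplus\theta_N$. Then $$\overleftarrow{V}=(V^{\theta_N})^*\circ V\circ V^{\theta_M}.$$
   Context: A quantum relation from $M\subseteq\mathcal B(H)$ to $N\subseteq\mathcal B(K)$ is a weak$^*$-closed $N'$-$M'$-bimodule $V\subseteq\mathcal B(H,K)$; $V^*=\{v^*:v\in V\}$; composition is $V\circ W=\overline{\mathrm{lin}}^{\,w^*}\{vw:v\in V,w\in W\}$ (weak$^*$-closed linear span), which is associative. Pullback: choose dilations $\theta_M(x)=u_M^*(x\otimes1)u_M$ $(x\in M_1)$ and $\theta_N(y)=u_N^*(y\otimes 1)u_N$ $(y\in N_1)$ with bounded operators $u_M\colon H_2\to H_1\otimes L_M$ and $u_N\colon K_2\to K_1\otimes L_N$. The pullback $\overleftarrow{V}$ of $V$ along $\theta_M\oplus\theta_N$ is the weak$^*$-closure of $u_N^*(V\bar\otimes\mathcal B(L_M,L_N))u_M$ in $\mathcal B(H_2,K_2)$, where $V\bar\otimes\mathcal B(L_M,L_N)$ is the weak$^*$-closed linear span of $\{v\otimes t\}$ in $\mathcal B(H_1\otimes L_M,K_1\otimes L_N)$. It is a quantum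 relation from $M_2$ to $N_2$, independent of the dilations chosen. (Equivalently, it is the pullback of $V$, viewed as a quantum relation over $M_1\oplus N_1$ in $\mathcal B(H_1\oplus K_1)$, along the map $\theta_M\oplus\theta_N\colon M_1\oplus N_1\to M_2\oplus N_2$.) For a normal completely positive map $\theta\colon N\to M$ with $M\subseteq\mathcal B(H)$, $N\subseteq\mathcal B(K)$, choose $v\in\mathcal B(H,K\otimes L)$ with $\theta(y)=v^*(y\otimes1)v$ $(y\in N)$; then $V^\theta=\overline{\mathrm{lin}}^{\,w^*}\{y'(1\otimes\langle\xi|)v:\xi\in L,y'\in N'\}\subseteq\mathcal B(H,K)$, a quantum relation from $M$ to $N$ independent of the dilation; here $\langle\xi|\colon\eta\mapsto(\xi|\eta)$. Thus $V^{\theta_M}\subseteq\mathcal B(H_2,H_1)$ and $V^{\theta_N}\subseteq\mathcal B(K_2,K_1)$. *)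

(* Defs.v *)
From HB Require Import structures.
From mathcomp Require Import all_boot all_order all_algebra.
From mathcomp Require Import sesquilinear complex.
From mathcomp Require Import all_classical all_reals all_analysis.

Set Implicit Arguments.
Unset Strict Implicit.
Unset Printing Implicit Defensive.

Import Order.TTheory GRing.Theory Num.Theory.
Import numFieldNormedType.Exports.

Local Open Scope classical_set_scope.
Local Open Scope ring_scope.
Local Open Scope complex_scope.

(* As in the library, [hdot] is linear in its first argument and conjugate
   linear in the second one. *)
HB.mixin Record isHilbert (R : realType) T & CompleteNormedModule R[i] T := {
  hdot : {dot T for (@Num.conj R[i])} ;
  hdot_norm : forall x : T, hdot x x = `|x| ^+ 2
}.

#[short(type="hilbertType")]
HB.structure Definition Hilbert (R : realType) :=
  {T of isHilbert R T & CompleteNormedModule R[i] T}.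

(* The inner product (x | y) is linear in y. *)
Definition inner (R : realType) (H : hilbertType R) (x y : H) : R[i] :=
  hdot y x.
Notation "'( x | y )" := (inner x y)
  (at level 0, x, y at level 200, format "''(' x  |  y )") : ring_scope.

Section BoundedOperators.
Context {R : realType}.
Implicit Types H K L : hilbertType R.

Definition bounded_op_pred {H K} : {pred H -> K} :=
  fun f => `[< linear f /\ continuous f >].

Lemma bounded_op_submod H K : submod_closed (@bounded_op_pred H K).
Proof.
split=> [|a f g /asboolP[fl fc] /asboolP[gl gc]]; apply/asboolP; split.
- by move=> b x y; rewrite /= scaler0 addr0.
- exact: cst_continuous.
- move=> b x y; rewrite /= !fctE fl gl !scalerDr !scalerA (mulrC a b).
  by rewrite addrACA.
- move=> x; apply: cvgD; last exact: gc.
  by apply: cvgZl_tmp; exact: fc.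
Qed.

HB.instance Definition _ H K :=
  GRing.isSubmodClosed.Build R[i] (H -> K) (@bounded_op_pred H K)
    (@bounded_op_submod H K).

Record bounded_op H K := BoundedOp {
  bounded_op_fun :> H -> K ;
  bounded_op_subproof : bounded_op_fun \in @bounded_op_pred H K
}.

HB.instance Definition _ H K := [isSub for @bounded_op_fun H K].
HB.instance Definition _ H K := [Choice of bounded_op H K by <:].
HB.instance Definition _ H K := [SubChoice_isSubLmodule of bounded_op H K by <:].

Lemma bounded_op_id_subproof H : id \in @bounded_op_pred H H.
Proof. by apply/asboolP; split => // x; exact: cvg_id. Qed.

Definition idop H : bounded_op H H := BoundedOp (bounded_op_id_subproof H).

Lemma bounded_op_comp_subproof H K L (S : bounded_op K L) (T : bounded_op H K) :
  S \o T \in @bounded_op_pred H L.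
Proof.
case: S T => S /= /asboolP[Sl Sc] [T /= /asboolP[Tl Tc]].
apply/asboolP; split => [a x y|x /=]; first by rewrite /= Tl Sl.
exact: continuous_comp (Tc x) (Sc _).
Qed.

Definition compop H K L (S : bounded_op K L) (T : bounded_op H K) :
  bounded_op H L := BoundedOp (bounded_op_comp_subproof S T).

End BoundedOperators.
Notation "S \c T" := (compop S T)
  (at level 50, left associativity, format "S  \c  T") : ring_scope.

Section WeakStar.
Context {R : realType}.
Implicit Types H K : hilbertType R.

Definition square_summable H (x : nat -> H) :=
  cvgn (series (fun n => `|x n| ^+ 2 : R[i]^o)).

(* The predual of B(H, K), that is, the trace class operators from K to H:
   the functionals T |-> \sum_n (y_n | T x_n) with square summable (x_n) and
   (y_n). *)
Definition predual H K : set (bounded_op H K -> R[i]^o) :=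
  [set w | exists x : nat -> H, exists y : nat -> K,
    [/\ square_summable x, square_summable y &
        forall T : bounded_op H K,
          series (fun n => '(y n | T (x n)) : R[i]^o) @ \oo --> w T]].

Definition predual_eval H K (T : bounded_op H K) :
    prod_topology (fun _ : @predual H K => R[i]^o) :=
  fun w => set_val w T.

(* The topology of [bounded_op H K] is the weak* one, not the norm topology. *)
HB.instance Definition _ H K := Topological.copy (bounded_op H K)
  (initial_topology (@predual_eval H K)).

End WeakStar.

Section Operators.
Context {R : realType}.
Implicit Types H K L : hilbertType R.

Definition subspace_set (U : lmodType R[i]) (A : set U) :=
  A 0 /\ forall (a : R[i]) (x y : U), A x -> A y -> A (a *: x + y).

Definition lin (U : lmodType R[i]) (A : set U) : set U :=
  smallest (@subspace_set U) A.

(* [closure] is taken for the weak* topology. *)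
Definition wspan H K (A : set (bounded_op H K)) : set (bounded_op H K) :=
  closure (lin A).

(* The adjoint exists by the Riesz representation theorem, and is unique; the
   default value 0 of [xget] is never used. *)
Definition adj H K (T : bounded_op H K) : bounded_op K H :=
  xget 0 [set S : bounded_op K H | forall x y, '(y | T x) = '(S y | x)].

Definition von_neumann_algebra H (M : set (bounded_op H H)) :=
  [/\ subspace_set M, M (idop H), (forall S T, M S -> M T -> M (S \c T)),
      (forall T, M T -> M (adj T)) & closed M].

Definition commutant H (M : set (bounded_op H H)) : set (bounded_op H H) :=
  [set T | forall S, M S -> T \c S = S \c T].

(* The matrix X acts on the Hilbert sum of n copies of H. *)
Definition positive_mx H n (X : 'M[bounded_op H H]_n) :=
  forall xi : 'I_n -> H, 0 <= \sum_i \sum_j '(xi i | X i j (xi j)).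

(* A map theta : M1 -> M2 is given by a function on B(H1) of which only the
   restriction to M1 matters. *)
Record normal_cp H1 H2 (M1 : set (bounded_op H1 H1))
    (M2 : set (bounded_op H2 H2))
    (theta : bounded_op H1 H1 -> bounded_op H2 H2) : Prop := NormalCP {
  ncp_image : forall x, M1 x -> M2 (theta x) ;
  ncp_linear : forall (a : R[i]) x y, M1 x -> M1 y ->
    theta (a *: x + y) = a *: theta x + theta y ;
  ncp_normal : {within M1, continuous theta} ;
  ncp_positive : forall n (X : 'M[bounded_op H1 H1]_n),
    (forall i j, M1 (X i j)) -> positive_mx X -> positive_mx (map_mx theta X)
}.

(* A Hilbert tensor product of H and L, which is unique up to a unitary. *)
Record htensor H L := HTensor {
  htensor_space :> hilbertType R ;
  tens : {bilinear H -> L -> htensor_space} ;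
  tens_inner : forall h h' l l',
    '(tens h l | tens h' l') = '(h | h') * '(l | l') ;
  tens_dense : closure (lin [set tens h l | h in setT & l in setT]) = setT
}.

(* The operators v (x) t and 1 (x) <xi|; here too [xget] selects the unique
   element of a nonempty set. *)
Definition optens H1 L1 H2 L2 (E1 : htensor H1 L1) (E2 : htensor H2 L2)
    (v : bounded_op H1 H2) (t : bounded_op L1 L2) : bounded_op E1 E2 :=
  xget 0 [set S : bounded_op E1 E2 |
    forall h l, S (tens E1 h l) = tens E2 (v h) (t l)].

Definition bra_slice H L (E : htensor H L) (xi : L) : bounded_op E H :=
  xget 0 [set S : bounded_op E H |
    forall h l, S (tens E h l) = '(xi | l) *: h].

Definition vNtens H K L1 L2 (E1 : htensor H L1) (E2 : htensor K L2)
    (V : set (bounded_op H K)) : set (bounded_op E1 E2) :=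
  wspan [set optens E1 E2 v t | v in V & t in setT].
Arguments vNtens {H K L1 L2} E1 E2 V.

Definition quantum_relation H K (M : set (bounded_op H H))
    (N : set (bounded_op K K)) (V : set (bounded_op H K)) :=
  [/\ subspace_set V, closed V &
      forall y v x, commutant N y -> V v -> commutant M x ->
        V (y \c v \c x)].

Definition qrel_adj H K (V : set (bounded_op H K)) : set (bounded_op K H) :=
  [set adj v | v in V].

Definition qrel_comp H K L (V : set (bounded_op K L))
    (W : set (bounded_op H K)) : set (bounded_op H L) :=
  wspan [set v \c w | v in V & w in W].

(* A dilation theta(x) = u^* (x (x) 1) u of a map on M1. *)
Record dilation H1 H2 (M1 : set (bounded_op H1 H1))
    (theta : bounded_op H1 H1 -> bounded_op H2 H2) := Dilation {
  dil_space : hilbertType R ;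
  dil_tensor : htensor H1 dil_space ;
  dil_op : bounded_op H2 dil_tensor ;
  dilE : forall x, M1 x ->
    theta x = adj dil_op \c optens dil_tensor dil_tensor x (idop dil_space)
                         \c dil_op
}.

(* V^theta for theta : N -> M with N in B(K) and M in B(H); the result is a
   quantum relation from M to N. *)
Definition cp_qrel H K (N : set (bounded_op K K))
    (theta : bounded_op K K -> bounded_op H H) (D : dilation N theta) :
    set (bounded_op H K) :=
  wspan [set y \c bra_slice (dil_tensor D) xi \c dil_op D |
         y in commutant N & xi in setT].

Definition pullback H1 H2 K1 K2 (M1 : set (bounded_op H1 H1))
    (N1 : set (bounded_op K1 K1))
    (thetaM : bounded_op H1 H1 -> bounded_op H2 H2)
    (thetaN : bounded_op K1 K1 -> bounded_op K2 K2)
    (DM : dilation M1 thetaM) (DN : dilation N1 thetaN)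
    (V : set (bounded_op H1 K1)) : set (bounded_op H2 K2) :=
  closure [set adj (dil_op DN) \c S \c dil_op DM |
           S in vNtens (dil_tensor DM) (dil_tensor DN) V].

End Operators.

(* Main.v *)
Require Import Defs.
From HB Require Import structures.
From mathcomp Require Import all_boot all_order all_algebra.
From mathcomp Require Import sesquilinear complex.
From mathcomp Require Import all_classical all_reals all_analysis.
From mathcomp Require Import ring.

(** Write [u_M], [u_N] for the operators of the two dilations, [<xi|] for the
    slice map given by a vector [xi] of the auxiliary space, and [|xi>] for its
    adjoint.  When the same dilations are used on both sides, the right hand
    side is the weak* closed span of the operators

      [(y' <eta| u_N)^* v x' <xi| u_M = u_N^* |eta> (y'^* v x') <xi| u_M],

    with [x'], [y'] in the commutants and [v] in [V].  As [V] is a bimodule over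
    the commutants, these are the operators [u_N^* (v (x) |eta><xi|) u_M]: the
    part of the pullback that comes from the rank one operators
    [t = |eta><xi|].  This gives one inclusion ([sub_pullback]).  For the other
    one ([pullback_sub]) an arbitrary [t] has to be replaced by rank one
    operators, and this is possible because the identity of a tensor product is
    a weak* limit of the operators [\sum_i |e_i><e_i|], with [(e_i)] finite
    orthonormal families ([slice_wspan]).

    The two sides of the statement use unrelated dilations, so one also needs
    that [V^theta] does not depend on the dilation ([cp_qrel_sub]).  Two
    dilations of [theta] give the same inner products between the vectors
    [(y (x) 1) u xi], hence a partial isometry [W] with [u' = W u] that
    intertwines the amplifications [y (x) 1] ([intertwiner]).  Then
    [<xi| u' = (<xi| W) u], and splitting [<xi| W] as the weak* limit of
    [\sum_i (<xi| W |e_i>) <e_i|] makes it a limit of sums of generators for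
    the first dilation, since [<xi| W |e_i>] lies in the commutant.

    Two tools carry the analysis.  First, a subspace of a product of Hilbert
    spaces on which the second coordinate is bounded by the first one is the
    graph of a restriction of a bounded operator ([graph_extension]); this
    yields adjoints, the amplifications [y (x) 1] and the intertwiner.
    Secondly, a norm bounded strong limit is a weak* limit
    ([bounded_strong_closure]), because a functional of the predual is, up to a
    small error on bounded sets, a finite sum of vector functionals. *)

Set Implicit Arguments.
Unset Strict Implicit.
Unset Printing Implicit Defensive.

Import Order.TTheory GRing.Theory Num.Theory.
Import numFieldNormedType.Exports.

Local Open Scope classical_set_scope.
Local Open Scope ring_scope.

(** * Inner products *)

Section InnerProduct.
Context {R : realType} {H : hilbertType R}.
Implicit Types x y z : H.

Lemma innerC x y : '(x | y) = ('(y | x))^*.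
Proof. by rewrite /inner hermC /= expr0 mul1r. Qed.

Lemma innerDr x y z : '(x | y + z) = '(x | y) + '(x | z).
Proof. by rewrite /inner linearDl. Qed.

Lemma innerZr x (a : R[i]) y : '(x | a *: y) = a * '(x | y).
Proof. by rewrite /inner linearZl_LR. Qed.

Lemma innerDl x y z : '(x + y | z) = '(x | z) + '(y | z).
Proof. by rewrite /inner linearDr. Qed.

Lemma innerZl x (a : R[i]) y : '(a *: x | y) = a^* * '(x | y).
Proof. by rewrite /inner linearZr_LR. Qed.

Lemma inner0r x : '(x | 0) = 0.
Proof. by rewrite /inner linear0l. Qed.

Lemma inner0l x : '(0 | x) = 0.
Proof. by rewrite /inner linear0r. Qed.

Lemma innerNr x y : '(x | - y) = - '(x | y).
Proof. by rewrite /inner linearNl. Qed.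

Lemma innerNl x y : '(- x | y) = - '(x | y).
Proof. by rewrite /inner linearNr. Qed.

Lemma innerBr x y z : '(x | y - z) = '(x | y) - '(x | z).
Proof. by rewrite innerDr innerNr. Qed.

Lemma innerBl x y z : '(x - y | z) = '(x | z) - '(y | z).
Proof. by rewrite innerDl innerNl. Qed.

Lemma inner_sumr (I : Type) (r : seq I) (P : pred I) x (f : I -> H) :
  '(x | \sum_(i <- r | P i) f i) = \sum_(i <- r | P i) '(x | f i).
Proof. by rewrite /inner linear_sumlz. Qed.

Lemma inner_suml (I : Type) (r : seq I) (P : pred I) x (f : I -> H) :
  '(\sum_(i <- r | P i) f i | x) = \sum_(i <- r | P i) '(f i | x).
Proof. by rewrite /inner linear_sumr. Qed.

Lemma innerxx x : '(x | x) = `|x| ^+ 2.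
Proof. exact: hdot_norm. Qed.

Lemma inner_eqr x y : (forall z, '(z | x) = '(z | y)) -> x = y.
Proof.
move=> e; apply/eqP; rewrite -subr_eq0 -normr_eq0 -sqrf_eq0 -innerxx.
by rewrite innerBr e subrr.
Qed.

Lemma inner_eql x y : (forall z, '(x | z) = '(y | z)) -> x = y.
Proof. by move=> e; apply: inner_eqr => z; rewrite innerC e -innerC. Qed.

(** The vector [|y|^2 x - (y | x) y] has a nonnegative square norm. *)
Lemma cauchy_schwarz x y : `|'(x | y)| <= `|x| * `|y|.
Proof.
have [->|y0] := eqVneq y 0; first by rewrite inner0r !normr0 mulr0.
have y2 : 0 < `|y| ^+ 2 by rewrite exprn_gt0 // normr_gt0.
rewrite -ler_sqr ?nnegrE ?mulr_ge0 // exprMn normCK -(ler_pM2l y2) -subr_ge0.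
have := exprn_ge0 2 (normr_ge0 (`|y| ^+ 2 *: x - '(y | x) *: y)).
rewrite -(innerxx (_ - _)) innerBr !innerBl !innerZr !innerZl !innerxx -innerC.
rewrite (geC0_conj (ltW y2)) (innerC x y) conjCK.
by congr (0 <= _); ring.
Qed.

End InnerProduct.

(** * Riesz representation along a graph *)

(** Elements of [R[i]] above a common bound share its imaginary part, so that
    the infimum can be taken on real parts. *)
Lemma complex_inf (R : realType) (A : set R[i]) (b : R[i]) : A !=set0 ->
  (forall a, A a -> b <= a) ->
  exists2 m : R[i], (forall a, A a -> m <= a) &
    forall e : R[i], 0 < e -> exists2 a, A a & a < m + e.
Proof.
move=> [a0 Aa0] Ab.
have hb : has_inf (@complex.Re R @` A).
  split; first by exists (complex.Re a0), a0.
  exists (complex.Re b) => _ [a /Ab + <-].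
  by rewrite lecE => /andP[].
exists (inf (@complex.Re R @` A) +i* complex.Im b)%C => [a Aa|e e0].
  rewrite lecE /=; have := Ab _ Aa; rewrite lecE => /andP[/eqP -> _].
  rewrite eqxx /=; apply: ge_inf; first exact: hb.2.
  by exists a.
move: e0; rewrite ltcE /= => /andP[/eqP ei er].
have [_ [a Aa <-] lta] := inf_adherent er hb.
exists a => //; case: e ei er lta => er ei /= -> _ lta.
have := Ab _ Aa; rewrite ltcE lecE /= => /andP[/eqP -> _].
by rewrite addr0 eqxx.
Qed.

Lemma le_small (F : numFieldType) (a b K : F) : 0 < K ->
  (forall e : F, 0 < e -> a <= b + e * K) -> a <= b.
Proof.
move=> K0 h; apply/ler_addgt0Pr => e e0.
by have := h (e / K); rewrite divfK ?gt_eqF //; apply; rewrite divr_gt0.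
Qed.

Lemma eq0_small (F : numFieldType) (a K : F) : 0 <= a -> 0 < K ->
  (forall e : F, 0 < e -> a <= e * K) -> a = 0.
Proof.
move=> a0 K0 h; apply/eqP; rewrite eq_le a0 andbT.
by apply: (le_small K0) => e e0; rewrite add0r; exact: h.
Qed.

(** Minimising [|p.1|^2 - 2 Re (y | p.2)] over the points [p] of a subspace [G]
    of [E * F] represents the functional [p |-> (y | p.2)] by a vector of [E].
    The graph itself is the datum, so that the bound alone makes the functional
    well defined. *)
Section Riesz.
Context {R : realType} {E F : hilbertType R}.
Variables (G : set (E * F)) (C : R[i]) (y : F).
Hypotheses (subG : subspace_set G) (C0 : 0 <= C)
  (boundG : forall p, G p -> `|p.2| <= C * `|p.1|).

Let J (p : E * F) : R[i] :=
  '(p.1 | p.1) - ('(y | p.2) + '(p.2 | y)).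

Let J_mid (p q : E * F) :
  `|p.1 - q.1| ^+ 2 = 2 * J p + 2 * J q - 4 * J (2^-1 *: p + 2^-1 *: q).
Proof.
have h2 : (2^-1 : R[i])^* = 2^-1 by rewrite geC0_conj // invr_ge0.
rewrite /J -innerxx innerBr !innerBl /= !(innerDr, innerDl, innerZr, innerZl) h2.
by field.
Qed.

Let J_low p : G p -> - (`|y| * C) ^+ 2 <= J p.
Proof.
move=> Gp; rewrite /J innerxx.
have h : '(y | p.2) + '(p.2 | y) <= 2 * (`|y| * (C * `|p.1|)).
  have hy : `|'(y | p.2)| <= `|y| * (C * `|p.1|).
    apply: le_trans (cauchy_schwarz _ _) _.
    by rewrite ler_wpM2l // boundG.
  have hr : '(y | p.2) + '(p.2 | y) \is Num.real.
    by rewrite CrealE rmorphD /= -!innerC addrC.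
  apply: le_trans (real_ler_norm hr) _; apply: le_trans (ler_normD _ _) _.
  by rewrite [in X in _ + X]innerC norm_conjC mulr_natl mulr2n lerD.
have Cr : `|p.1| - `|y| * C \is Num.real.
  by rewrite rpredB ?rpredM ?normr_real // ger0_real.
have sq : 0 <= (`|p.1| - `|y| * C) ^+ 2 by rewrite real_exprn_even_ge0.
rewrite -subr_ge0 in h; rewrite -subr_ge0; apply: le_trans (addr_ge0 sq h) _.
by rewrite le_eqVlt; apply/orP; left; apply/eqP; ring.
Qed.

Lemma riesz_graph : exists2 r : E, closure (fst @` G) r &
  forall p, G p -> '(r | p.1) = '(y | p.2).
Proof.
have [G0 Glin] := subG.
have [m mJ mJe] : exists2 m : R[i], (forall p, G p -> m <= J p) &
    forall e : R[i], 0 < e -> exists2 p, G p & J p < m + e.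
  have [||m h1 h2] := @complex_inf R (J @` G) (- (`|y| * C) ^+ 2).
  - by exists (J 0), 0.
  - by move=> _ [p Gp <-]; exact: J_low.
  exists m => [p Gp|e /h2[_ [p Gp <-]]]; first by apply: h1; exists p.
  by exists p.
(* The first coordinates of the almost minimal points form a Cauchy filter. *)
pose B (e : R[i]) := fst @` [set p | G p /\ J p < m + e].
pose Phi := filter_from [set e : R[i] | 0 < e] B.
have subB (e e' : R[i]) : e <= e' -> B e `<=` B e'.
  move=> ee' _ [p [Gp Jp] <-]; exists p => //; split=> //.
  by apply: lt_le_trans Jp _; rewrite lerD2l.
have FF : ProperFilter Phi.
  apply: filter_from_proper => [|e /mJe[p Gp Jp]]; last by exists p.1, p.
  apply: filter_from_filter; first by exists 1 => /=.
  move=> e e' /= e0 e'0.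
  have [ee'|e'e] := real_leP (gtr0_real e0) (gtr0_real e'0).
    by exists e => // x Bx; split=> //; exact: subB Bx.
  by exists e' => // x Bx; split=> //; apply: subB Bx; exact: ltW.
(* The parallelogram identity at the midpoint, where J is at least m. *)
have near_min p q (e : R[i]) : G p -> G q -> J p < m + e -> J q < m + e ->
    `|p.1 - q.1| ^+ 2 < 4 * e.
  move=> Gp Gq Jp Jq; rewrite J_mid.
  have Gm : G (2^-1 *: p + 2^-1 *: q).
    by apply: (Glin) => //; rewrite -[_ *: q]addr0; exact: (Glin).
  have := mJ _ Gm; rewrite -(ler_pM2l (_ : 0 < 4)) // => Jm.
  have -> : 4 * e = 2 * (m + e) + 2 * (m + e) - 4 * m by ring.
  by rewrite ltr_leB // ltrD // ltr_pM2l.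
have : cvg Phi.
  apply: cauchy_cvg; apply: cauchy_exP => eps eps0.
  have e0 : 0 < (eps / 2) ^+ 2 by rewrite exprn_gt0 // divr_gt0.
  have [p Gp Jp] := mJe _ e0.
  exists p.1; exists ((eps / 2) ^+ 2) => // _ [q [Gq Jq] <-].
  rewrite -ball_normE /= -ltr_sqr ?nnegrE ?normr_ge0 1?ltW //.
  apply: lt_le_trans (near_min _ _ _ Gp Gq Jp Jq) _.
  by rewrite le_eqVlt; apply/orP; left; apply/eqP; field.
move=> /cvg_ex[r Fr].
have Br (eta e : R[i]) : 0 < eta -> 0 < e ->
    exists p, [/\ G p, J p < m + e & `|r - p.1| < eta].
  move=> eta0 e0; have : Phi (ball r eta) by apply: Fr; exact: nbhsx_ballx.
  move=> FB; have FBe : Phi (B e) by exists e.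
  have [x [rx [p [Gp Jp] px]]] := filter_ex (filterI FB FBe).
  by exists p; split=> //; rewrite px; move: rx; rewrite -ball_normE.
exists r.
  move=> U /nbhs_ballP[eta eta0 rU].
  have [p [Gp _ rp]] := Br eta 1 eta0 ltr01.
  by exists p.1; split; [exists p | apply: rU; rewrite -ball_normE].
move=> q Gq; apply/eqP; rewrite -subr_eq0 -normr_eq0; apply/eqP.
apply: (@eq0_small R[i] _ (`|q.1| + 1)) => // eta eta0.
have K0 : 0 < `|q.1| ^+ 2 + 1 by rewrite ltr_wpDl // exprn_ge0.
have e0 : 0 < eta ^+ 2 / (`|q.1| ^+ 2 + 1) by rewrite divr_gt0 // exprn_gt0.
have [p [Gp Jp rp]] := Br _ _ eta0 e0.
(* J cannot decrease much when p is moved along q: this bounds the defect d at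
   p, and the limit r differs from p.1 by less than eta. *)
set d := '(p.1 | q.1) - '(y | q.2).
have -> : '(r | q.1) - '(y | q.2) = '(r - p.1 | q.1) + d.
  by rewrite innerBl /d; ring.
rewrite mulrDr mulr1; apply: le_trans (ler_normD _ _) _.
apply: lerD.
  apply: le_trans (cauchy_schwarz _ _) _.
  by rewrite ler_wpM2r // ltW.
rewrite -ler_sqr ?nnegrE ?normr_ge0 ?(ltW eta0) //.
set s := (`|q.1| ^+ 2 + 1)^-1 in e0 Jp *.
have s0 : 0 < s by rewrite invr_gt0.
(* Up to the 1 added in s, which keeps s defined when q.1 = 0, this is the step
   that minimises J on the line through p in the direction q. *)
have : m <= J (- (s * d^*) *: q + p).
  by apply: mJ; exact: (Glin).
have -> : J (- (s * d^*) *: q + p) =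
    J p + s ^+ 2 * `|d| ^+ 2 * `|q.1| ^+ 2 - 2 * s * `|d| ^+ 2.
  have sc : s^* = s by rewrite geC0_conj // ltW.
  rewrite /J /= !(innerDr, innerDl, innerZr, innerZl) -innerxx normCK.
  rewrite !rmorphN !rmorphM /= conjCK.
  rewrite sc /d rmorphB /= -!innerC.
  by ring.
set D := `|d| ^+ 2 => mle.
have sQ : s ^+ 2 * D * `|q.1| ^+ 2 = s * D - s ^+ 2 * D.
  by rewrite /s; field; rewrite gt_eqF.
have : 0 < s * (eta ^+ 2 - D).
  have lt : m < m + eta ^+ 2 * s + s ^+ 2 * D * `|q.1| ^+ 2 - 2 * s * D.
    by apply: le_lt_trans mle _; rewrite ltrD2r ltrD2r.
  rewrite -subr_gt0 sQ in lt; apply: lt_le_trans lt _.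
  rewrite -subr_ge0 [X in 0 <= X](_ : _ = s ^+ 2 * D); last by ring.
  by rewrite mulr_ge0 // exprn_ge0 // ltW.
by rewrite pmulr_rgt0 // subr_gt0 => /ltW.
Qed.
End Riesz.

(** * Adjoints and operators determined by their graph *)

Section Operators.
Context {R : realType}.
Implicit Types E F H K L : hilbertType R.

Lemma op_eq H K (S T : bounded_op H K) : (forall x, S x = T x) -> S = T.
Proof. by move=> e; apply/val_inj/funext. Qed.

(** The ascription matters in these rules: without it the coercion to functions
    is inserted below the operation, which is then the pointwise one. *)
Lemma op_addE H K (S T : bounded_op H K) x :
  (S + T : bounded_op H K) x = S x + T x.
Proof. by []. Qed.

Lemma op_scaleE H K a (T : bounded_op H K) x :
  (a *: T : bounded_op H K) x = a *: T x.
Proof. by []. Qed.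

Lemma op_sumE H K I (r : seq I) (P : pred I) (T : I -> bounded_op H K) x :
  (\sum_(i <- r | P i) T i : bounded_op H K) x = \sum_(i <- r | P i) T i x.
Proof. by elim/big_rec2: _ => // i y1 y2 _ <-. Qed.

Lemma op_lin H K (T : bounded_op H K) : linear T.
Proof. by case: T => T /= /asboolP[]. Qed.

Lemma op_cont H K (T : bounded_op H K) : continuous T.
Proof. by case: T => T /= /asboolP[]. Qed.

HB.instance Definition _ H K (T : bounded_op H K) :=
  GRing.isLinear.Build R[i] H K _ T (@op_lin H K T).

Lemma bounded_op_bound H K (T : bounded_op H K) :
  exists2 C : R[i], 0 < C & forall x, `|T x| <= C * `|x|.
Proof.
have := @op_cont _ _ T; move/linear_bounded_continuous/linear_boundedP.
by move=> /pinfty_ex_gt0[C C0 hC]; exists C.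
Qed.

Lemma bounded_op_of_linear H K (f : H -> K) (C : R[i]) : 0 <= C -> linear f ->
  (forall x, `|f x| <= C * `|x|) ->
  exists T : bounded_op H K, forall x, T x = f x.
Proof.
move=> C0 fl fC.
pose g : {linear H -> K} := HB.pack f (GRing.isLinear.Build _ _ _ _ f fl).
have fc : continuous f.
  apply: (@bounded_linear_continuous R[i] H K g); apply/linear_boundedP.
  exists C; split; first exact: ger0_real.
  by move=> r /ltW Cr x; apply: le_trans (fC x) _; rewrite ler_wpM2r.
have fP : f \in @bounded_op_pred R H K by apply/asboolP.
by exists (BoundedOp fP).
Qed.

Lemma closure_norm E (A : set E) (z : E) :
  closure A z <-> forall e : R[i], 0 < e -> exists2 x, A x & `|z - x| < e.
Proof.
split=> [cz e e0|h U /nbhs_ballP[e e0 zU]].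
  have [x [Ax]] := cz _ (nbhsx_ballx z e e0).
  by rewrite -ball_normE; exists x.
by have [x Ax zx] := h e e0; exists x; split=> //; apply: zU; rewrite -ball_normE.
Qed.

Lemma closure_orth E (A : set E) (r z : E) : closure A r ->
  (forall x, A x -> '(x | z) = 0) -> '(r | z) = 0.
Proof.
move=> /closure_norm rA Az; apply/eqP; rewrite -normr_eq0; apply/eqP.
apply: (@eq0_small R[i] _ (`|z| + 1)) => // e /rA[x Ax rx].
have -> : '(r | z) = '(r - x | z) by rewrite innerBl (Az x) // subr0.
apply: le_trans (cauchy_schwarz _ _) _.
by apply: ler_pM => //; [exact: ltW|rewrite lerDl].
Qed.

Lemma norm_le_inner E (x : E) (B : R[i]) : 0 <= B ->
  '(x | x) <= B * `|x| -> `|x| <= B.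
Proof.
move=> B0; rewrite innerxx expr2; have [->|x0] := eqVneq x 0.
  by rewrite normr0.
by rewrite ler_pM2r // normr_gt0.
Qed.

(** The adjoint of a densely or partially defined operator: its values are the
    vectors given by [riesz_graph], taken in the closure of the domain so that
    they are unique, hence linear in [y]. *)
Lemma adjoint_of_graph E F (G : set (E * F)) (C : R[i]) : 0 <= C ->
  subspace_set G -> (forall p, G p -> `|p.2| <= C * `|p.1|) ->
  exists T : bounded_op F E,
    (forall y p, G p -> '(T y | p.1) = '(y | p.2)) /\
    (forall y, closure (fst @` G) (T y)).
Proof.
move=> C0 subG boundG.
have /choice[f hf] y : exists r, closure (fst @` G) r /\
    forall p, G p -> '(r | p.1) = '(y | p.2).
  by have [r r1 r2] := riesz_graph y subG C0 boundG; exists r.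
have dom_orth z : (forall p, G p -> '(p.1 | z) = 0) -> forall y, '(f y | z) = 0.
  move=> pz y; have [clf _] := hf y.
  by apply: closure_orth clf _ => _ [p Gp <-]; exact: pz.
have fl : linear f.
  move=> a x y; apply/eqP; rewrite -subr_eq0; set z := _ - _.
  have : '(z | z) = 0.
    have oz p : G p -> '(p.1 | z) = 0.
      move=> Gp; rewrite innerC; apply/eqP; rewrite conjC_eq0 /z.
      rewrite innerBl innerDl innerZl.
      rewrite !(fun u => (hf u).2 p Gp).
      by rewrite innerDl innerZl subrr.
    by rewrite {1}/z innerBl innerDl innerZl !dom_orth // mulr0 addr0 subr0.
  by move/eqP; rewrite innerxx sqrf_eq0 normr_eq0.
have fb y : `|f y| <= C * `|y|.
  have [clf fE] := hf y; apply: norm_le_inner; first by rewrite mulr_ge0.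
  have K0 : 0 < C * `|y| + `|f y| + 1.
    by rewrite ltr_wpDl // addr_ge0 // mulr_ge0.
  apply: (le_small K0) => e e0.
  (* For a point p of the graph whose first coordinate is close to f y, the value
     (f y | p.1) = (y | p.2) is bounded through boundG. *)
  have [_ [p Gp <-] fp] := (closure_norm _ _).1 clf e e0.
  have p1 : `|p.1| <= `|f y| + e.
    have -> : p.1 = f y - (f y - p.1) by rewrite subKr.
    by apply: le_trans (ler_normB _ _) _; rewrite lerD2l ltW.
  have f0 : 0 <= '(f y | f y) by rewrite innerxx exprn_ge0.
  rewrite -(ger0_norm f0).
  have -> : '(f y | f y) = '(y | p.2) + '(f y | f y - p.1).
    by rewrite -fE // innerBr; ring.
  apply: le_trans (ler_normD _ _) _.
  have -> : C * `|y| * `|f y| + e * (C * `|y| + `|f y| + 1) =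
     `|y| * (C * (`|f y| + e)) + (`|f y| * e + e) by ring.
  apply: lerD.
    apply: le_trans (cauchy_schwarz _ _) _; rewrite ler_wpM2l //.
    by apply: le_trans (boundG _ Gp) _; rewrite ler_wpM2l.
  apply: le_trans (cauchy_schwarz _ _) _; apply: (@le_trans _ _ (`|f y| * e)).
    by rewrite ler_wpM2l // ltW.
  by rewrite lerDl ltW.
have [T TE] := bounded_op_of_linear C0 fl fb.
by exists T; split=> [y p Gp|y]; rewrite TE; have [h1 h2] := hf y => //; exact: h2.
Qed.

(** Adjoints are the case of the graph of an everywhere defined operator. *)
Lemma adj_exists H K (T : bounded_op H K) :
  exists S : bounded_op K H, forall x y, '(y | T x) = '(S y | x).
Proof.
have [C C0 TC] := bounded_op_bound T.
have [|p [x _ <-]//|S [SE _]] :=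
  @adjoint_of_graph H K [set p | exists2 x, True & (x, T x) = p] C (ltW C0).
- split=> [|a _ _ [x _ <-] [y _ <-]]; first by exists 0; rewrite ?linear0.
  by exists (a *: x + y); rewrite ?linearP.
- exact: TC.
by exists S => x y; rewrite -(SE y (x, T x)) //; exists x.
Qed.

Lemma adjE H K (T : bounded_op H K) x y : '(y | T x) = '(adj T y | x).
Proof.
have [S hS] := adj_exists T.
by rewrite /adj; case: xgetP => [S' _ ->//|/(_ S)].
Qed.

Lemma adj_eq H K (T : bounded_op H K) (S : bounded_op K H) :
  (forall x y, '(y | T x) = '(S y | x)) -> adj T = S.
Proof.
by move=> TS; apply: op_eq => y; apply: inner_eql => x; rewrite -adjE TS.
Qed.

Lemma adjEl H K (T : bounded_op H K) x y : '(T x | y) = '(x | adj T y).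
Proof. by rewrite innerC adjE -innerC. Qed.

Lemma adjK H K (T : bounded_op H K) : adj (adj T) = T.
Proof. by apply: adj_eq => x y; rewrite adjEl. Qed.

Lemma adj_comp H K L (S : bounded_op K L) (T : bounded_op H K) :
  adj (S \c T) = adj T \c adj S.
Proof. by apply: adj_eq => x y /=; rewrite !adjE. Qed.

Lemma adj_lin H K a (S T : bounded_op H K) :
  adj (a *: S + T) = a^* *: adj S + adj T.
Proof.
apply: adj_eq => x y.
by rewrite !op_addE !op_scaleE innerDr innerDl innerZr innerZl conjCK !adjE.
Qed.

(** The projection onto the closure of [D] comes from [riesz_graph] applied to
    the diagonal of [D]. *)
Lemma orth_decomp E (D : set E) (z : E) : subspace_set D ->
  exists2 p, closure D p & forall x, D x -> '(x | z - p) = 0.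
Proof.
move=> [D0 Dlin].
have [||p clp pE] := @riesz_graph R E E [set q | D q.1 /\ q.2 = q.1] 1 z _ ler01.
- by split=> // a x y [Dx ex] [Dy ey]; split; [exact: Dlin|rewrite /= ex ey].
- by move=> q [_ ->]; rewrite mul1r.
exists p => [|x Dx].
  by apply: closureS clp => _ [q [Dq _] <-].
rewrite innerC innerBl.
have /= -> := pE (x, x) (conj Dx erefl).
by rewrite subrr conjC0.
Qed.

(** The adjoint of the operator of [adjoint_of_graph] extends the graph, and it
    vanishes on the orthogonal complement of the domain because the range of
    the former lies in the closure of the domain. *)
Lemma graph_extension E F (G : set (E * F)) (C : R[i]) : 0 <= C ->
  subspace_set G -> (forall p, G p -> `|p.2| <= C * `|p.1|) ->
  exists T : bounded_op E F,
    (forall p, G p -> T p.1 = p.2) /\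
    (forall z, (forall p, G p -> '(p.1 | z) = 0) -> T z = 0).
Proof.
move=> C0 subG boundG; have [S [SE clS]] := adjoint_of_graph C0 subG boundG.
exists (adj S); split=> [p Gp|z oz]; apply: inner_eqr => y.
  by rewrite -adjEl SE.
by rewrite -adjEl inner0r; apply: closure_orth (clS y) _ => _ [p Gp <-]; exact: oz.
Qed.

Lemma op_closure0 E F (A : set E) (T : bounded_op E F) z : closure A z ->
  (forall x, A x -> T x = 0) -> T z = 0.
Proof.
move=> clz TA; apply: inner_eqr => y; rewrite inner0r adjE innerC.
rewrite (closure_orth clz) ?conjC0 // => x Ax.
by rewrite -adjEl TA // inner0l.
Qed.
End Operators.

(** * Linear spans and orthonormal expansions *)

Section Lin.
Context {R : realType}.
Implicit Types U : lmodType R[i].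

Lemma lin_subspace U (A : set U) : subspace_set (lin A).
Proof.
split=> [B [[]]//|a x y Ax Ay B [subB AB]].
by apply: subB.2; [exact: Ax|exact: Ay].
Qed.

Lemma sub_lin U (A : set U) : A `<=` lin A.
Proof. exact: sub_smallest. Qed.

Lemma lin_min U (A B : set U) : subspace_set B -> A `<=` B -> lin A `<=` B.
Proof. by move=> subB AB x; apply. Qed.

Lemma subspaceD U (A : set U) x y : subspace_set A -> A x -> A y -> A (x + y).
Proof. by move=> [_ A2] Ax Ay; rewrite -[x]scale1r; exact: A2. Qed.

Lemma subspace_sum U (A : set U) (I : eqType) (r : seq I) (f : I -> U) :
  subspace_set A -> (forall i, i \in r -> A (f i)) -> A (\sum_(i <- r) f i).
Proof.
move=> subA Af; rewrite big_seq; elim/big_ind: _ => //; first exact: subA.1.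
by move=> x y; exact: subspaceD.
Qed.
End Lin.

Section GramSchmidt.
Context {R : realType} {L : hilbertType R}.
Implicit Types (l : L) (e ls : seq L).

Definition fourier_sum e l := \sum_(x <- e) '(x | l) *: x.

Lemma orthonormal_inner e : orthonormal hdot e ->
  uniq e /\ {in e &, forall x y, '(x | y) = (x == y)%:R}.
Proof.
move=> /orthonormalP[ue oe]; split=> // x y xe ye.
by rewrite /inner oe // eq_sym.
Qed.

Lemma inner_fourier_sum e l x : orthonormal hdot e -> x \in e ->
  '(x | fourier_sum e l) = '(x | l).
Proof.
move=> /orthonormal_inner[ue oe] xe.
rewrite /fourier_sum inner_sumr (bigD1_seq x) //= innerZr (oe x x) // eqxx mulr1.
rewrite big1_seq ?addr0 // => y /andP[yx ye].
by rewrite innerZr (oe x y) // eq_sym (negbTE yx) mulr0.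
Qed.

(** Adding a vector [l] to the family either changes nothing or appends the
    normalised difference between [l] and its expansion. *)
Lemma gram_schmidt ls :
  exists2 e, orthonormal hdot e & forall l, l \in ls -> fourier_sum e l = l.
Proof.
elim: ls => [|l ls [e oe els]]; first by exists [::].
have [rl|rl] := eqVneq (fourier_sum e l) l.
  by exists e => // k; rewrite inE => /predU1P[->|/els].
pose r := l - fourier_sum e l.
have r0 : `|r| != 0 by rewrite normr_eq0 subr_eq0 eq_sym.
have re x : x \in e -> '(x | r) = 0.
  by move=> xe; rewrite innerBr inner_fourier_sum // subrr.
pose f := `|r|^-1 *: r.
have ff : '(f | f) = 1.
  rewrite innerZl innerZr innerxx geC0_conj ?invr_ge0 //.
  by rewrite mulrA -expr2 -exprMn mulVf // expr1n.
have ef x : x \in e -> '(x | f) = 0.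
  by move=> xe; rewrite innerZr re // mulr0.
have [ue ie] := orthonormal_inner oe.
have fe : f \notin e.
  by apply/negP => /ef; rewrite ff => /eqP; rewrite oner_eq0.
exists (f :: e).
  apply/orthonormalP; split; first by rewrite /= fe.
  have ef' x : x \in e -> (f == x) = false.
    by move=> xe; apply: contraNF fe => /eqP ->.
  move=> x y; rewrite !inE => /predU1P[->|xe] /predU1P[->|ye].
  - by rewrite eqxx -ff.
  - by rewrite ef' //; exact: ef.
  - by rewrite eq_sym ef' // -/(inner f x) innerC ef // conjC0.
  - by rewrite eq_sym; exact: ie.
move=> k; rewrite inE /fourier_sum big_cons -/(fourier_sum e k) => /predU1P[->|kls].
  have -> : '(f | l) = `|r|.
    rewrite -[X in '(f | X)](subrK (fourier_sum e l) l) -/r.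
    have fl : '(f | fourier_sum e l) = 0.
      rewrite inner_sumr big1_seq // => x /andP[_ xe].
      by rewrite innerZr (innerC f x) ef // conjC0 mulr0.
    rewrite innerDr fl addr0 innerZl innerxx geC0_conj ?invr_ge0 //.
    by rewrite expr2 mulrA mulVf // mul1r.
  by rewrite scalerA mulfV // scale1r subrK.
rewrite els // (_ : '(f | k) = 0) ?scale0r ?add0r //.
rewrite -(els k) // inner_sumr big1_seq // => x /andP[_ xe].
by rewrite innerZr (innerC f x) ef // conjC0 mulr0.
Qed.
End GramSchmidt.

(** * Slices of a tensor product *)

Section Tensor.
Context {R : realType} {H L : hilbertType R} (E : htensor H L).
Implicit Types (h : H) (l xi : L) (z : E) (e ls : seq L).

Lemma norm_tens h l : `|tens E h l| = `|h| * `|l|.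
Proof.
apply/eqP; rewrite -(eqrXn2 (_ : 0 < 2)%N) ?mulr_ge0 //.
by rewrite exprMn -!innerxx tens_inner.
Qed.

Lemma op_eq_tens F (S T : bounded_op E F) :
  (forall h l, S (tens E h l) = T (tens E h l)) -> S = T.
Proof.
move=> ST; apply: op_eq => z; apply/eqP; rewrite -subr_eq0; apply/eqP.
have clz : closure (lin [set tens E h l | h in setT & l in setT]) z.
  by rewrite tens_dense.
have [D DE] : exists D : bounded_op E F, forall x, D x = S x - T x.
  by exists (S - T).
rewrite -DE; apply: (op_closure0 clz) => x; move: x.
apply: lin_min => [|_ [h _ [l _ <-]] /=]; last by rewrite DE ST subrr.
by split=> [|a u v /= u0 v0]; rewrite ?linear0 // op_lin u0 v0 scaler0 addr0.
Qed.

(** The slice map [<xi|] is the adjoint of [h |-> h (x) xi], which is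
    bounded by the norm of [xi]; this avoids any extension from the algebraic
    tensor product. *)
Lemma bra_slice_exists xi : exists S : bounded_op E H,
  (forall h, adj S h = tens E h xi) /\
  forall h l, S (tens E h l) = '(xi | l) *: h.
Proof.
have [|||T TE] := @bounded_op_of_linear R H E (fun h => tens E h xi) `|xi|.
- exact: normr_ge0.
- by move=> a x y; rewrite linearPl.
- by move=> x; rewrite norm_tens mulrC.
exists (adj T); rewrite adjK; split=> // h l.
apply: inner_eqr => y.
by rewrite -adjEl TE tens_inner innerZr mulrC.
Qed.

Lemma bra_sliceE xi h l : bra_slice E xi (tens E h l) = '(xi | l) *: h.
Proof.
have [S [_ SE]] := bra_slice_exists xi.
by rewrite /bra_slice; case: xgetP => [S' _ ->//|/(_ S)].
Qed.

Lemma adj_bra_sliceE xi h : adj (bra_slice E xi) h = tens E h xi.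
Proof.
have [S [SE1 SE2]] := bra_slice_exists xi.
rewrite (_ : bra_slice E xi = S) //.
by apply: op_eq_tens => h' l; rewrite SE2 bra_sliceE.
Qed.

(** This is [1 (x) p], with [p] the projection onto the span of [e] when [e] is
    orthonormal. *)
Definition slice_proj e : bounded_op E E :=
  \sum_(x <- e) (adj (bra_slice E x) \c bra_slice E x).

Lemma slice_projE e z : slice_proj e z = \sum_(x <- e) tens E (bra_slice E x z) x.
Proof. by rewrite op_sumE; apply: eq_bigr => x _ /=; rewrite adj_bra_sliceE. Qed.

Lemma slice_proj_tens e h l : fourier_sum e l = l ->
  slice_proj e (tens E h l) = tens E h l.
Proof.
move=> el; rewrite slice_projE -[in RHS]el /fourier_sum linear_sumr.
by apply: eq_bigr => x _; rewrite bra_sliceE linearZr_LR linearZl_LR.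
Qed.

Lemma inner_slice_proj e z :
  '(z | slice_proj e z) = \sum_(x <- e) `|bra_slice E x z| ^+ 2.
Proof.
rewrite slice_projE inner_sumr; apply: eq_bigr => x _.
by rewrite -adj_bra_sliceE -adjEl innerxx.
Qed.

Lemma norm_tens_orthonormal K (F : htensor K L) e (f : L -> K) :
  orthonormal hdot e ->
  `|\sum_(x <- e) tens F (f x) x| ^+ 2 = \sum_(x <- e) `|f x| ^+ 2.
Proof.
move=> /orthonormal_inner[ue oe]; rewrite -innerxx inner_suml big_seq [RHS]big_seq.
apply: eq_bigr => x xe; rewrite inner_sumr (bigD1_seq x) //=.
rewrite tens_inner oe // eqxx mulr1 innerxx big1_seq ?addr0 // => y /andP[yx ye].
by rewrite tens_inner (oe x y) // eq_sym (negbTE yx) mulr0.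
Qed.

(** As [(P z | P z) = (z | P z)] for [P = slice_proj e], this is the
    Cauchy-Schwarz inequality. *)
Lemma slice_proj_le e z : orthonormal hdot e -> `|slice_proj e z| <= `|z|.
Proof.
move=> oe; apply: norm_le_inner => //.
rewrite innerxx slice_projE norm_tens_orthonormal // -inner_slice_proj -slice_projE.
have p0 : 0 <= '(z | slice_proj e z).
  by rewrite inner_slice_proj sumr_ge0 // => x _; rewrite exprn_ge0.
by rewrite -[leLHS]ger0_norm // cauchy_schwarz.
Qed.

Lemma slice_proj_lin z : lin [set tens E h l | h in setT & l in setT] z ->
  exists ls, forall e, (forall l, l \in ls -> fourier_sum e l = l) ->
    slice_proj e z = z.
Proof.
move: z; apply: lin_min => [|_ [h _ [l _ <-]]]; last first.
  by exists [:: l] => e els; rewrite slice_proj_tens // els // inE.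
split=> [|a x y [lx ex] [ly ey]]; first by exists [::] => e _; rewrite linear0.
exists (lx ++ ly) => e els; rewrite op_lin ex ?ey // => l ll; apply: els.
  by rewrite mem_cat ll orbT.
by rewrite mem_cat ll.
Qed.

(** On the algebraic tensor product [slice_proj e] is the identity as soon as
    the expansion along [e] fixes the finitely many vectors of [L] that occur.
    The general case follows by density, as these maps are contractions. *)
Lemma slice_proj_approx (zs : seq E) (eps : R[i]) : 0 < eps ->
  exists2 e, orthonormal hdot e &
    forall z, z \in zs -> `|slice_proj e z - z| < eps.
Proof.
move=> eps0.
suff [ls hls] : exists ls, forall e, orthonormal hdot e ->
    (forall l, l \in ls -> fourier_sum e l = l) ->
    forall z, z \in zs -> `|slice_proj e z - z| < eps.
  have [e oe els] := gram_schmidt ls.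
  by exists e => //; exact: hls.
elim: zs => [|z zs [ls hls]]; first by exists [::].
have eps2 : 0 < eps / 2 by rewrite divr_gt0.
have [w linw zw] : exists2 w, lin [set tens E h l | h in setT & l in setT] w &
    `|z - w| < eps / 2.
  by apply: (closure_norm _ _).1 => //; rewrite tens_dense.
have [lw hlw] := slice_proj_lin linw.
exists (lw ++ ls) => e oe els y; rewrite inE => /predU1P[->|yzs]; last first.
  by apply: hls => // l ll; apply: els; rewrite mem_cat ll orbT.
have -> : slice_proj e z - z = slice_proj e (z - w) - (z - w).
  rewrite linearB /= hlw ?opprB ?addrA ?subrK // => l ll.
  by apply: els; rewrite mem_cat ll.
apply: le_lt_trans (ler_normB _ _) _; rewrite (splitr eps).
by apply: ltrD => //; apply: le_lt_trans (slice_proj_le _ oe) _.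
Qed.

End Tensor.

Section OpTensor.
Context {R : realType} {H K L : hilbertType R}.
Variables (E1 : htensor H L) (E2 : htensor K L).
Implicit Types (v : bounded_op H K) (e ls : seq L).

(** The bound that [graph_extension] asks for holds because, on an element [z]
    of the algebraic tensor product, [v (x) 1] agrees with
    [Q e = \sum_i |e_i> v <e_i|] for some orthonormal [e], and [|Q e z|^2] is
    the sum of the [|v <e_i| z|^2]. *)
Lemma optens_id_exists v : exists S : bounded_op E1 E2,
  forall h l, S (tens E1 h l) = tens E2 (v h) l.
Proof.
have [C C0 vC] := bounded_op_bound v.
pose Q e : bounded_op E1 E2 :=
  \sum_(x <- e) (adj (bra_slice E2 x) \c v \c bra_slice E1 x).
have QE e z : Q e z = \sum_(x <- e) tens E2 (v (bra_slice E1 x z)) x.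
  by rewrite op_sumE; apply: eq_bigr => x _ /=; rewrite adj_bra_sliceE.
have QC e z : orthonormal hdot e -> `|Q e z| <= C * `|z|.
  move=> oe; rewrite -ler_sqr ?nnegrE ?mulr_ge0 ?(ltW C0) //.
  rewrite QE norm_tens_orthonormal // exprMn.
  apply: (@le_trans _ _ (C ^+ 2 * `|slice_proj E1 e z| ^+ 2)).
    rewrite slice_projE norm_tens_orthonormal // mulr_sumr; apply: ler_sum => x _.
    by rewrite -exprMn ler_sqr ?nnegrE ?mulr_ge0 ?(ltW C0) // vC.
  by rewrite ler_pM2l ?exprn_gt0 // ler_sqr ?nnegrE // slice_proj_le.
pose G : set (E1 * E2) := lin [set p |
  exists h l, p = (tens E1 h l, tens E2 (v h) l)].
have GQ p : G p -> exists ls, forall e,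
    (forall l, l \in ls -> fourier_sum e l = l) -> Q e p.1 = p.2.
  move: p; apply: lin_min => [|_ [h [l ->]]]; last first.
    exists [:: l] => e /(_ l (mem_head _ _)) el; rewrite QE /=.
    rewrite -[in RHS]el /fourier_sum linear_sumr; apply: eq_bigr => x _.
    by rewrite bra_sliceE linearZ /= linearZr_LR linearZl_LR.
  split=> [|a p q [lp ep] [lq eq]]; first by exists [::] => e _; rewrite linear0.
  exists (lp ++ lq) => e els; rewrite op_lin ep ?eq // => l ll; apply: els.
    by rewrite mem_cat ll orbT.
  by rewrite mem_cat ll.
have [|p /GQ[ls hls]|S [SE _]] := graph_extension (ltW C0) (G := G).
- exact: lin_subspace.
- have [e oe els] := gram_schmidt ls.
  by rewrite -(hls _ els); exact: QC.
exists S => h l; apply: (SE (tens E1 h l, tens E2 (v h) l)).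
by apply: sub_lin; exists h, l.
Qed.

Lemma optens_idE v h l :
  optens E1 E2 v (idop L) (tens E1 h l) = tens E2 (v h) l.
Proof.
have [S SE] := optens_id_exists v.
by rewrite /optens; case: xgetP => [S' _ ->//|/(_ S)].
Qed.

Lemma optens_id_ket v xi : optens E1 E2 v (idop L) \c adj (bra_slice E1 xi) =
  adj (bra_slice E2 xi) \c v.
Proof. by apply: op_eq => h /=; rewrite !adj_bra_sliceE optens_idE. Qed.

Lemma bra_optens_id v xi : bra_slice E2 xi \c optens E1 E2 v (idop L) =
  v \c bra_slice E1 xi.
Proof.
by apply: op_eq_tens => h l /=; rewrite optens_idE !bra_sliceE linearZ.
Qed.
End OpTensor.

(** Adjoint of [bra_optens_id]. *)
Lemma adj_optens_id (R : realType) (H K L : hilbertType R)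
    (E1 : htensor H L) (E2 : htensor K L) (v : bounded_op H K) :
  adj (optens E1 E2 v (idop L)) = optens E2 E1 (adj v) (idop L).
Proof.
apply: op_eq_tens => k l; rewrite optens_idE -!adj_bra_sliceE.
have := congr1 (@adj _ _ _) (bra_optens_id E1 E2 v l).
by rewrite !adj_comp => /(congr1 (fun T : bounded_op _ _ => T k)).
Qed.

Lemma optens_rank1 (R : realType) (H K L1 L2 : hilbertType R)
    (E1 : htensor H L1) (E2 : htensor K L2) (v : bounded_op H K) xi eta :
  exists t, optens E1 E2 v t = adj (bra_slice E2 eta) \c v \c bra_slice E1 xi.
Proof.
have [|||t tE] := @bounded_op_of_linear R L1 L2 (fun l => '(xi | l) *: eta)
  (`|eta| * `|xi|).
- by rewrite mulr_ge0.
- by move=> a x y; rewrite innerDr innerZr scalerDl scalerA.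
- move=> x; rewrite normrZ mulrC -mulrA.
  by rewrite ler_wpM2l // cauchy_schwarz.
exists t; have tensE h l : (adj (bra_slice E2 eta) \c v \c bra_slice E1 xi)
    (tens E1 h l) = tens E2 (v h) (t l).
  by rewrite /= bra_sliceE linearZ adj_bra_sliceE tE linearZl_LR linearZr_LR.
rewrite /optens; case: xgetP => [S' _ S'E|/(_ _ tensE)//].
by apply: op_eq_tens => h l; rewrite S'E tensE.
Qed.

(** * Functionals of the predual and the weak* topology *)

Lemma cvg_initial_topology (S : choiceType) (T : topologicalType) (f : S -> T)
    (F : set_system S) (s : S) : Filter F ->
  f @ F --> f s -> F --> (s : initial_topology f).
Proof.
move=> FF cf U [?/= [[W oW <-]]] /= Ws /filterS; apply; apply: cf.
exact: open_nbhs_nbhs.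
Qed.

Section WeakStar.
Context {R : realType}.
Implicit Types H K : hilbertType R.

Lemma conj_cvg T (F : set_system T) (FF : Filter F) (f : T -> R[i]^o) (l : R[i]^o) :
  f @ F --> l -> (fun t => (f t)^* : R[i]^o) @ F --> (l^* : R[i]^o).
Proof.
move=> /cvgrPdist_lt fl; apply/cvgrPdist_lt => e e0.
by apply: filterS (fl e e0) => t; rewrite -rmorphB norm_conjC.
Qed.

Lemma weakstar_cvg H K (F : set_system (bounded_op H K)) (T : bounded_op H K) :
  Filter F ->
  (forall w, predual w -> w @ F --> w T) -> F --> T.
Proof.
move=> FF Fw; apply: cvg_initial_topology; apply/cvg_sup => w.
apply: cvg_initial_topology.
exact: (Fw (set_val w) (set_valP w)).
Qed.

Lemma predual_continuous H K (w : bounded_op H K -> R[i]^o) :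
  predual w -> continuous w.
Proof.
move=> pw T.
pose i : @predual R H K := SigSub (mem_set pw).
have c : @predual_eval R H K @ nbhs T --> predual_eval T.
  exact: (@initial_continuous _ _ (@predual_eval R H K) T).
have /cvg_sup/(_ i) ci := c.
pose pr (f : forall _ : @predual R H K, R[i]^o) := f i.
by move=> U /(@initial_continuous _ _ pr (predual_eval T))/ci.
Qed.

(** Continuity into the weak* topology is tested on the functionals of the
    predual. *)
Lemma weakstar_continuous (X : topologicalType) H K (f : X -> bounded_op H K) :
  (forall w, predual w -> continuous (w \o f)) -> continuous f.
Proof. by move=> cf x; apply: weakstar_cvg => w pw; exact: cf. Qed.

Lemma predual_lin H K (w : bounded_op H K -> R[i]^o) a S T : predual w ->
  w (a *: S + T) = a * w S + w T.
Proof.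
move=> [x [y [_ _ wE]]].
have c1 := wE (a *: S + T).
have e : series (fun n => '(y n | (a *: S + T : bounded_op H K) (x n)) : R[i]^o) =
    (fun n => a *: series (fun n => '(y n | S (x n)) : R[i]^o) n +
              series (fun n => '(y n | T (x n)) : R[i]^o) n).
  apply/funext => n; rewrite /series /= scaler_sumr -big_split.
  by apply: eq_bigr => k _; rewrite /= innerDr innerZr.
rewrite e in c1; apply: (cvg_unique (@norm_hausdorff _ _) c1).
by apply: cvgD; [apply: cvgZl_tmp|]; exact: wE.
Qed.
End WeakStar.

(** * Weak* continuity of the operations *)

Section SquareSummable.
Context {R : realType}.
Implicit Types H K : hilbertType R.

(** Monotone convergence inside [R[i]]: the limit comes from the infimum of the
    remainders [B - series a N]. *)
Lemma cvg_series_ge0 (a : nat -> R[i]^o) (B : R[i]) : (forall n, 0 <= a n) ->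
  (forall N, series a N <= B) -> cvgn (series a).
Proof.
move=> a0 aB.
have [|_ [N _ <-]|m mB mBe] := @complex_inf R (range (fun N => B - series a N)) 0.
- by exists (B - series a 0%N), 0%N.
- by rewrite subr_ge0.
have incr N M : (N <= M)%N -> series a N <= series a M.
  by move=> NM; rewrite -subr_ge0 sub_series_geq // sumr_ge0.
apply/cvg_ex; exists (B - m); apply/cvgrPdist_lt => e e0.
have [_ [N _ <-] hN] := mBe e e0.
exists N => // M /= NM.
have mM : m <= B - series a M by apply: mB; exists M.
rewrite ger0_norm; last by rewrite subr_ge0 lerBrDr addrC -lerBrDr.
apply: (@le_lt_trans _ _ (B - m - series a N)).
  by rewrite lerD2l lerN2; exact: incr.
by rewrite addrAC ltrBlDl.
Qed.

Lemma square_summable_bounded H (x : nat -> H) : square_summable x ->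
  exists B : R[i], forall N, series (fun n => `|x n| ^+ 2 : R[i]^o) N <= B.
Proof.
move=> /cvg_ex[l /cvgrPdist_lt /(_ 1 ltr01)[N _ hN]].
exists (`|l| + 1) => M.
have a0 k : 0 <= `|x k| ^+ 2 by rewrite exprn_ge0.
have s0 k : 0 <= series (fun n => `|x n| ^+ 2 : R[i]^o) k by rewrite sumr_ge0.
apply: (@le_trans _ _ (series (fun n => `|x n| ^+ 2 : R[i]^o) (maxn M N))).
  by rewrite -subr_ge0 sub_series_geq ?leq_maxl // sumr_ge0.
rewrite -[leLHS]ger0_norm // -[X in `|X|](subrK l) addrC.
apply: le_trans (ler_normD _ _) _; rewrite lerD2l distrC ltW //.
by apply: hN; rewrite /= leq_maxr.
Qed.

Lemma square_summable_op H K (x : nat -> H) (T : bounded_op H K) :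
  square_summable x -> square_summable (fun n => T (x n)).
Proof.
move=> /square_summable_bounded[B xB]; have [C C0 TC] := bounded_op_bound T.
apply: (@cvg_series_ge0 _ (C ^+ 2 * B)) => [n|N]; first by rewrite exprn_ge0.
apply: (@le_trans _ _ (C ^+ 2 * series (fun n => `|x n| ^+ 2 : R[i]^o) N)).
  rewrite /series /= mulr_sumr; apply: ler_sum => n _.
  by rewrite -exprMn ler_sqr ?nnegrE ?mulr_ge0 ?(ltW C0) // TC.
by rewrite ler_pM2l ?exprn_gt0 //; exact: xB.
Qed.

Lemma square_summable_tail H (x : nat -> H) (e : R[i]) : square_summable x ->
  0 < e -> exists N, forall N' M, (N <= N')%N -> (N' <= M)%N ->
    \sum_(N' <= n < M) `|x n| ^+ 2 < e.
Proof.
move=> /cvg_ex[l /cvgrPdist_lt cl] e0.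
have [|N _ hN] := cl (e / 2); first by rewrite divr_gt0.
exists N => N' M NN' N'M.
rewrite -(@sub_series_geq _ (fun n => `|x n| ^+ 2 : R[i]^o)) //.
have s0 : 0 <= series (fun n => `|x n| ^+ 2 : R[i]^o) M -
    series (fun n => `|x n| ^+ 2 : R[i]^o) N'.
  by rewrite sub_series_geq // sumr_ge0 // => n _; rewrite exprn_ge0.
rewrite -[ltLHS]ger0_norm // (splitr e).
have -> : series (fun n => `|x n| ^+ 2 : R[i]^o) M -
    series (fun n => `|x n| ^+ 2 : R[i]^o) N' =
    (l - series (fun n => `|x n| ^+ 2 : R[i]^o) N') -
    (l - series (fun n => `|x n| ^+ 2 : R[i]^o) M) by ring.
apply: le_lt_trans (ler_normB _ _) _.
by apply: ltrD; apply: hN => //=; exact: leq_trans N'M.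
Qed.

End SquareSummable.

Section WeakStarContinuity.
Context {R : realType}.
Implicit Types H K : hilbertType R.

Lemma predual_comp H H' K K' (A : bounded_op K K') (B : bounded_op H' H)
    (w : bounded_op H' K' -> R[i]^o) : predual w ->
  predual (fun T : bounded_op H K => w (A \c T \c B)).
Proof.
move=> [x [y [sx sy wE]]].
exists (fun n => B (x n)), (fun n => adj A (y n)).
split; [exact: square_summable_op|exact: square_summable_op|move=> T].
have := wE (A \c T \c B).
rewrite (_ : (fun n => '(y n | (A \c T \c B) (x n))) =
  fun n => '(adj A (y n) | T (B (x n)))) //.
by apply/funext => n; rewrite -adjE.
Qed.

Lemma compop_continuous H H' K K' (A : bounded_op K K') (B : bounded_op H' H) :
  continuous (fun T : bounded_op H K => A \c T \c B).
Proof.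
by apply: weakstar_continuous => w /(predual_comp A B)/predual_continuous.
Qed.

(** Since [(y | T^* x)] is the conjugate of [(x | T y)], the two sequences
    exchange their roles and a conjugation appears. *)
Lemma predual_adj H K (w : bounded_op K H -> R[i]^o) : predual w ->
  predual (fun T : bounded_op H K => (w (adj T))^* : R[i]^o).
Proof.
move=> [x [y [sx sy wE]]]; exists y, x; split=> // T.
rewrite (_ : series _ = fun n =>
  (series (fun n => '(y n | adj T (x n)) : R[i]^o) n)^* : R[i]^o).
  by apply: conj_cvg; exact: wE.
apply/funext => n; rewrite /series /= rmorph_sum; apply: eq_bigr => k _ /=.
by rewrite -adjEl innerC.
Qed.

Lemma adj_continuous H K : continuous (@adj R H K).
Proof.
apply: weakstar_continuous => w /predual_adj/predual_continuous cw T.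
have -> : w \o @adj R H K = fun S : bounded_op H K => ((w (adj S))^*)^* : R[i]^o.
  by apply/funext => S /=; rewrite conjCK.
exact: conj_cvg (cw T).
Qed.

Lemma affine_continuous H K (a : R[i]) (S : bounded_op H K) :
  continuous (fun T : bounded_op H K => a *: T + S).
Proof.
apply: weakstar_continuous => w pw.
rewrite (_ : w \o _ = fun T => a *: w T + w S).
  move=> T; have c : w @ nbhs T --> w T := predual_continuous pw (x := T).
  exact: (cvgD (cvgZl_tmp (k := a) c) (cvg_cst (w S))).
by apply/funext => T /=; rewrite predual_lin.
Qed.

Lemma closure_image (X Y : topologicalType) (f : X -> Y) (A : set X) (B : set Y) :
  continuous f -> (forall x, A x -> closure B (f x)) ->
  forall x, closure A x -> closure B (f x).
Proof.
move=> cf AB x clx; apply: (@closed_closure _ B).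
move=> U Ufx; have [z [Az Uz]] := clx _ (cf x U Ufx).
by exists (f z); split=> //; exact: AB.
Qed.

(** Addition is used only in one variable at a time, first with the other
    summand in [A], then with the other summand in the closure of [A]. *)
Lemma closure_subspace H K (A : set (bounded_op H K)) : subspace_set A ->
  subspace_set (closure A).
Proof.
move=> [A0 A2]; split=> [|a S T clS clT]; first exact: subset_closure.
have clST T' : A T' -> closure A (a *: S + T').
  move=> AT'; move: S clS; apply: closure_image (@affine_continuous _ _ a T') _.
  by move=> S AS; apply: subset_closure; exact: A2.
have -> : a *: S + T = 1 *: T + a *: S by rewrite scale1r addrC.
apply: (closure_image (@affine_continuous _ _ 1 (a *: S)) _ clT) => T' AT'.
by rewrite scale1r addrC; exact: clST.
Qed.

Lemma wspan_subspace H K (A : set (bounded_op H K)) : subspace_set (wspan A).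
Proof. exact/closure_subspace/lin_subspace. Qed.

Lemma sub_wspan H K (A : set (bounded_op H K)) : A `<=` wspan A.
Proof. by move=> T AT; apply: subset_closure; exact: sub_lin. Qed.

Lemma wspan_min H K (A B : set (bounded_op H K)) : subspace_set B -> closed B ->
  A `<=` B -> wspan A `<=` B.
Proof.
move=> subB clB AB; rewrite /wspan closureE; apply: smallest_sub => //.
exact: lin_min.
Qed.

End WeakStarContinuity.

(** * Bounded strong approximation *)

Section StrongApproximation.
Context {R : realType}.
Implicit Types H K L : hilbertType R.

Lemma mul_le_sumsq (F : numDomainType) (a b : F) : 0 <= a -> 0 <= b ->
  a * b <= a ^+ 2 + b ^+ 2.
Proof.
move=> a0 b0; have ab0 : 0 <= a * b by rewrite mulr_ge0.
have r : a - b \is Num.real by rewrite rpredB // ger0_real.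
have sq : 0 <= (a - b) ^+ 2 by rewrite real_exprn_even_ge0.
rewrite -subr_ge0 [X in 0 <= X](_ : _ = (a - b) ^+ 2 + a * b); last by ring.
exact: addr_ge0.
Qed.

(** On a norm bounded set the tail of the series of a predual functional is
    uniformly small, and the remaining terms see only the finitely many
    vectors [x_n], [n < N]. *)
Lemma predual_small H K (w : bounded_op H K -> R[i]^o) (C eps : R[i]) :
  predual w -> 0 <= C -> 0 < eps ->
  exists xs : seq H, exists2 eta : R[i], 0 < eta &
    forall D : bounded_op H K, (forall x, `|D x| <= C * `|x|) ->
      (forall x, x \in xs -> `|D x| < eta) -> `|w D| < eps.
Proof.
move=> [x [y [sx sy wE]]] C0 eps0.
have C3 : 0 < 2 * C + 3 by rewrite ltr_wpDl // mulr_ge0.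
(* The error terms are: d from the truncation of the series, d from the first
   N terms, and C (d + d) from the tails; one d is left over. *)
pose d := eps / (2 * C + 3).
have d0 : 0 < d by rewrite divr_gt0.
have [Nx hNx] := square_summable_tail sx d0.
have [Ny hNy] := square_summable_tail sy d0.
pose N := maxn Nx Ny.
have Y0 : 0 < \sum_(0 <= n < N) `|y n| + 1.
  by rewrite ltr_wpDl // sumr_ge0.
exists [seq x n | n <- index_iota 0 N], (d / (\sum_(0 <= n < N) `|y n| + 1)).
  by rewrite divr_gt0.
move=> D DC Dx.
have /cvgrPdist_lt /(_ d d0)[N1 _ hN1] := wE D.
pose M := maxn N1 N.
have NM : (N <= M)%N by rewrite leq_maxr.
have -> : w D = (w D - series (fun n => '(y n | D (x n)) : R[i]^o) M) +
    (\sum_(0 <= n < N) '(y n | D (x n)) + \sum_(N <= n < M) '(y n | D (x n))).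
  rewrite -big_cat_nat // -/(series (fun n => '(y n | D (x n)) : R[i]^o) M).
  by rewrite subrK.
have -> : eps = d + (d + C * (d + d) + d).
  by rewrite /d; field; rewrite gt_eqF.
apply: le_lt_trans (ler_normD _ _) _; apply: ltr_leD.
  by apply: hN1; rewrite /= leq_maxl.
apply: le_trans (ler_normD _ _) _; rewrite -addrA; apply: lerD.
  apply: le_trans (ler_norm_sum _ _ _) _.
  apply: (@le_trans _ _ (\sum_(0 <= n < N)
    `|y n| * (d / (\sum_(0 <= n < N) `|y n| + 1)))).
    rewrite big_nat_cond [leRHS]big_nat_cond; apply: ler_sum => n.
    rewrite andbT => /andP[_ nN]; apply: le_trans (cauchy_schwarz _ _) _.
    by rewrite ler_wpM2l // ltW // Dx // map_f // mem_index_iota.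
  rewrite -mulr_suml mulrCA ger_pMr // ler_pdivrMr // mul1r.
  by rewrite lerDl.
apply: (@le_trans _ _ (C * (d + d))); last by rewrite lerDl ltW.
apply: le_trans (ler_norm_sum _ _ _) _.
apply: (@le_trans _ _ (\sum_(N <= n < M) C * (`|x n| ^+ 2 + `|y n| ^+ 2))).
  apply: ler_sum => n _; apply: le_trans (cauchy_schwarz _ _) _.
  apply: (@le_trans _ _ (`|y n| * (C * `|x n|))); first by rewrite ler_wpM2l.
  by rewrite mulrCA ler_wpM2l // mulrC mul_le_sumsq.
rewrite -mulr_sumr big_split ler_wpM2l //= lerD // ltW //.
  by apply: hNx => //; rewrite leq_maxl.
by apply: hNy => //; rewrite leq_maxr.
Qed.

(** The sets of elements of [A] that are bounded by [C] and close to [T] on a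
    finite family of vectors form a filter base, and [predual_small] says that
    this filter converges weak* to [T]. *)
Lemma bounded_strong_closure H K (A : set (bounded_op H K)) (T : bounded_op H K)
    (C : R[i]) : 0 <= C ->
  (forall (xs : seq H) (eps : R[i]), 0 < eps ->
     exists S : bounded_op H K, [/\ A S, forall x, `|S x| <= C * `|x| &
       forall x, x \in xs -> `|S x - T x| < eps]) ->
  closure A T.
Proof.
move=> C0 hA.
pose B (p : seq H * R[i]) := [set S : bounded_op H K |
  [/\ A S, forall x, `|S x| <= C * `|x| &
      forall x, x \in p.1 -> `|S x - T x| < p.2]].
pose Phi := filter_from [set p : seq H * R[i] | 0 < p.2] B.
have PhiF : ProperFilter Phi.
  apply: filter_from_proper => [|[xs e] /= /(hA xs)[S BS]]; last by exists S.
  apply: filter_from_filter; first by exists ([::], 1); rewrite /= ltr01.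
  move=> [xs e] [ys f] /= e0 f0.
  have [g [g0 ge gf]] : exists g : R[i], [/\ 0 < g, g <= e & g <= f].
    have [ef|/ltW fe] := real_leP (gtr0_real e0) (gtr0_real f0).
      by exists e.
    by exists f.
  exists (xs ++ ys, g) => // S [AS SC /= Sx].
  by split; split=> //= x xx; [apply: lt_le_trans ge|apply: lt_le_trans gf];
    apply: Sx; rewrite mem_cat xx ?orbT.
rewrite closureEcvg; exists Phi; first by [].
split; last first.
  move=> U AU; exists ([::], 1); first exact: ltr01.
  by move=> S [AS _ _]; exact: AU.
apply: weakstar_cvg => w pw; apply/cvgrPdist_lt => eps eps0.
have [CT CT0 TC] := bounded_op_bound T.
have CC : 0 <= CT + C by rewrite addr_ge0 // ltW.
have [xs [eta eta0 hw]] := predual_small pw CC eps0.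
exists (xs, eta) => // S [AS SC Sx] /=.
have DE x : (-1 *: S + T : bounded_op H K) x = T x - S x.
  by rewrite op_addE op_scaleE scaleN1r addrC.
have -> : w T - w S = w (-1 *: S + T) by rewrite predual_lin // mulN1r addrC.
apply: hw => x; rewrite DE.
  by apply: le_trans (ler_normB _ _) _; rewrite mulrDl lerD.
by move=> xx; rewrite distrC Sx.
Qed.

(** The weak* decomposition [T = \sum_i T |e_i><e_i|], through which arbitrary
    operators on a tensor product are reduced to slices. *)
Lemma slice_wspan H K L (E : htensor H L) (T : bounded_op E K) :
  wspan [set T \c adj (bra_slice E xi) \c bra_slice E xi | xi in setT] T.
Proof.
have [C C0 TC] := bounded_op_bound T.
apply: (bounded_strong_closure (ltW C0)) => xs eps eps0.
have epsC : 0 < eps / C by rewrite divr_gt0.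
have [e oe he] := slice_proj_approx xs epsC.
exists (\sum_(x <- e) (T \c adj (bra_slice E x) \c bra_slice E x)).
have SE z : (\sum_(x <- e) (T \c adj (bra_slice E x) \c bra_slice E x)
    : bounded_op E K) z = T (slice_proj E e z).
  by rewrite /slice_proj !op_sumE linear_sum.
split=> [|x|x xx].
- apply: subspace_sum => [|x _]; first exact: lin_subspace.
  by apply: sub_lin; exists x.
- rewrite SE; apply: le_trans (TC _) _; rewrite ler_pM2l //.
  exact: slice_proj_le.
rewrite SE -linearB; apply: le_lt_trans (TC _) _.
by rewrite mulrC -ltr_pdivlMr // he.
Qed.

End StrongApproximation.

(** * Independence of the dilation *)

Section QuantumRelations.
Context {R : realType}.
Implicit Types H K L : hilbertType R.

Lemma compop_linear H K H' K' (A : bounded_op K K') (B : bounded_op H' H) a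
    (S T : bounded_op H K) :
  A \c (a *: S + T) \c B = a *: (A \c S \c B) + (A \c T \c B).
Proof.
apply: op_eq => x; rewrite op_addE op_scaleE.
have compE (X Y Z : hilbertType R) (P : bounded_op Y Z) (Q : bounded_op X Y) z :
  (P \c Q) z = P (Q z) by [].
by rewrite !compE op_addE op_scaleE op_lin.
Qed.

(** [S |-> A S B] is linear and weak* continuous, so membership of [A S B] in a
    weak* closed subspace need only be checked on generators. *)
Lemma wspan_compop H K H' K' (A : bounded_op K K') (B : bounded_op H' H)
    (F : set (bounded_op H K)) (X : set (bounded_op H' K')) :
  subspace_set X -> closed X -> (forall S, F S -> X (A \c S \c B)) ->
  forall S, wspan F S -> X (A \c S \c B).
Proof.
move=> [X0 X2] clX FX; apply: wspan_min => //.
  split=> [|a S T XS XT]; last by rewrite /= compop_linear; exact: X2.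
  by rewrite /= (_ : _ \c _ = 0) //; apply: op_eq => x /=; rewrite linear0.
by have /continuous_closedP/(_ X clX) := @compop_continuous R H H' K K' A B.
Qed.

Lemma compop_idl H K (T : bounded_op H K) : idop K \c T = T.
Proof. exact: op_eq. Qed.

Lemma compop_idr H K (T : bounded_op H K) : T \c idop H = T.
Proof. exact: op_eq. Qed.

Lemma compopA H K L H' (S : bounded_op L H') (T : bounded_op K L)
  (U : bounded_op H K) : S \c (T \c U) = S \c T \c U.
Proof. exact: op_eq. Qed.

Section Dilations.
Context {H K : hilbertType R} (N : set (bounded_op K K)).
Context (theta : bounded_op K K -> bounded_op H H).
Hypothesis vN : von_neumann_algebra N.

Let amp (D : dilation N theta) (y : bounded_op K K) :
    bounded_op (dil_tensor D) (dil_tensor D) :=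
  optens (dil_tensor D) (dil_tensor D) y (idop (dil_space D)).

Lemma ampM (D : dilation N theta) y z : amp D y \c amp D z = amp D (y \c z).
Proof. by apply: op_eq_tens => h l; rewrite /= /amp !optens_idE. Qed.

(** The inner products of the vectors [(y (x) 1) u xi] only depend on
    [theta]. *)
Lemma inner_amp (D : dilation N theta) y z xi eta : N y -> N z ->
  '(amp D y (dil_op D xi) | amp D z (dil_op D eta)) =
  '(xi | theta (adj y \c z) eta).
Proof.
move=> Ny Nz; have [_ _ NM Nadj _] := vN.
rewrite (dilE D) /=; last by apply: (NM) => //; exact: Nadj.
rewrite -/(amp D _) -ampM -adjEl /=.
by rewrite [in RHS]/amp -adj_optens_id -adjEl.
Qed.

(** By [inner_amp], sending [(y (x) 1) u xi] to [(y (x) 1) u' xi] is isometric;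
    [W] is the extension of this map by zero on the orthogonal complement of
    its domain.  It intertwines because the domain and its complement are both
    stable under the amplifications, as [N] is stable under products and
    adjoints. *)
Lemma intertwiner (D D' : dilation N theta) :
  exists W : bounded_op (dil_tensor D) (dil_tensor D'),
    W \c dil_op D = dil_op D' /\ forall z, N z -> W \c amp D z = amp D' z \c W.
Proof.
have [[N0 N2] N1 NM Nadj _] := vN.
pose gen := [set p | exists y xi, N y /\
  p = (amp D y (dil_op D xi), amp D' y (dil_op D' xi))].
pose G := lin gen.
have subG : subspace_set G := lin_subspace gen.
have isoG p q : G p -> G q -> '(p.1 | q.1) = '(p.2 | q.2).
  move=> Gp; move: q; apply: lin_min => [|q [z [eta [Nz ->]]]] /=.
    split=> [|a q q' e e'] /=; first by rewrite !inner0r.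
    by rewrite !innerDr !innerZr e e'.
  move: p Gp; apply: lin_min => [|p [y [xi [Ny ->]]]] /=.
    split=> [|a r r' e e'] /=; first by rewrite !inner0l.
    by rewrite !innerDl !innerZl e e'.
  by rewrite !inner_amp.
have [p Gp|W [WG W0]] := graph_extension ler01 subG.
  by rewrite mul1r -ler_sqr ?nnegrE // -!innerxx isoG.
have ampG z p : N z -> G p -> G (amp D z p.1, amp D' z p.2).
  move=> Nz; move: p; apply: lin_min => [|p [y [xi [Ny ->]]]].
    split=> [|a p q Gp Gq] /=; first by rewrite !linear0; exact: subG.1.
    rewrite !op_lin; exact: (subG.2 a _ _ Gp Gq).
  apply: sub_lin; exists (z \c y), xi; split; first exact: NM.
  by rewrite -!ampM.
exists W; split=> [|z Nz].
  apply: op_eq => xi /=.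
  have amp_id (D0 : dilation N theta) x : amp D0 (idop K) x = x.
    rewrite (_ : amp D0 (idop K) = idop _) //.
    by apply: op_eq_tens => h l; rewrite /amp optens_idE.
  rewrite -(amp_id D (dil_op D xi)) -(amp_id D' (dil_op D' xi)).
  by apply: (WG (_, _)); apply: sub_lin; exists (idop K), xi.
apply: op_eq => x.
have sub1 : subspace_set (fst @` G).
  split=> [|a _ _ [p Gp <-] [q Gq <-]]; first by exists 0 => //; exact: subG.1.
  by exists (a *: p + q) => //; exact: subG.2.
have [p clp xp] := orth_decomp x sub1.
have [Z ZE] : exists Z : bounded_op (dil_tensor D) (dil_tensor D'), forall x,
    Z x = W (amp D z x) - amp D' z (W x).
  by exists ((W \c amp D z) - (amp D' z \c W)).
apply/eqP; rewrite -subr_eq0 /= -ZE -(subrK p x) linearD /=.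
rewrite (op_closure0 clp) => [|_ [q Gq <-]]; last first.
  rewrite ZE (WG _ Gq) (WG (_, _) (ampG _ _ Nz Gq)) subrr //.
rewrite addr0 ZE [W (x - p)]W0 => [|q Gq]; last by apply: xp; exists q.
rewrite linear0 subr0 W0 // => q Gq.
rewrite adjE adj_optens_id; apply: xp.
exists (amp D (adj z) q.1, amp D' (adj z) q.2) => //.
by apply: ampG => //; exact: Nadj.
Qed.

(** With [T = y <xi| W], the generator [y <xi| u'] is [T u], and each slice
    [T |l>] lies in the commutant of [N], since [T (z (x) 1) = z T]. *)
Lemma cp_qrel_sub (D D' : dilation N theta) : cp_qrel D' `<=` cp_qrel D.
Proof.
have [W [Wu Wamp]] := intertwiner D D'.
apply: wspan_min => [||_ [y Ny [xi _ <-]]].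
- exact: wspan_subspace.
- exact: closed_closure.
rewrite -Wu compopA; set T := _ \c W.
have Tamp z : N z -> T \c amp D z = z \c T.
  move=> Nz; rewrite /T -compopA Wamp // compopA -(compopA y) bra_optens_id.
  by rewrite !compopA Ny.
rewrite -(compop_idl T).
apply: (wspan_compop (X := cp_qrel D) _ _ _ (@slice_wspan _ _ _ _ _ T))
  => [||_ [l _ <-]].
- exact: wspan_subspace.
- exact: closed_closure.
rewrite compop_idl; apply: sub_wspan.
exists (T \c adj (bra_slice (dil_tensor D) l)); last by exists l.
move=> z Nz; rewrite -compopA -(optens_id_ket (dil_tensor D)).
by rewrite compopA Tamp // -compopA.
Qed.

End Dilations.
End QuantumRelations.

(** * The pullback as a composition *)

Section Pullback.
Context {R : realType} {H1 H2 K1 K2 : hilbertType R}.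
Context (M1 : set (bounded_op H1 H1)) (N1 : set (bounded_op K1 K1)).
Context (thetaM : bounded_op H1 H1 -> bounded_op H2 H2).
Context (thetaN : bounded_op K1 K1 -> bounded_op K2 K2).
Hypothesis vN_N1 : von_neumann_algebra N1.
Context (V : set (bounded_op H1 K1)).
Hypothesis qV : quantum_relation M1 N1 V.
Context (DM : dilation M1 thetaM) (DN : dilation N1 thetaN).

Lemma commutant_adj (H : hilbertType R) (M : set (bounded_op H H))
    (y : bounded_op H H) :
  von_neumann_algebra M -> commutant M y -> commutant M (adj y).
Proof.
move=> [_ _ _ Madj _] My z /Madj/My/(congr1 (@adj R H H)).
by rewrite !adj_comp adjK.
Qed.

Lemma id_commutant (H : hilbertType R) (M : set (bounded_op H H)) :
  commutant M (idop H).
Proof. by move=> z _; rewrite compop_idl compop_idr. Qed.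

Lemma pullback_subspace : subspace_set (pullback DM DN V).
Proof.
apply: closure_subspace.
have [v0 v2] : subspace_set (@vNtens R _ _ _ _ (dil_tensor DM) (dil_tensor DN) V).
  exact: wspan_subspace.
split=> [|a _ _ [S VS <-] [T VT <-]].
  exists 0 => //; apply: op_eq => x /=; exact: linear0.
by exists (a *: S + T); [exact: v2|rewrite compop_linear].
Qed.

(** [slice_wspan] applied to [u_N^* (v (x) t)] replaces [t] by the rank one
    operators [|t xi><xi|]. *)
Lemma pullback_sub : pullback DM DN V `<=`
  qrel_comp (qrel_comp (qrel_adj (cp_qrel DN)) V) (cp_qrel DM).
Proof.
set X := qrel_comp _ _.
have subX : subspace_set X by exact: wspan_subspace.
have clX : closed X by exact: closed_closure.
have rank1 v xi eta : V v ->
    X (adj (dil_op DN) \c adj (bra_slice (dil_tensor DN) eta) \c v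
       \c bra_slice (dil_tensor DM) xi \c dil_op DM).
  move=> Vv; apply: sub_wspan.
  exists (adj (dil_op DN) \c adj (bra_slice (dil_tensor DN) eta) \c v).
    apply: sub_wspan.
    exists (adj (dil_op DN) \c adj (bra_slice (dil_tensor DN) eta)).
      exists (bra_slice (dil_tensor DN) eta \c dil_op DN); last first.
        by rewrite adj_comp.
      apply: sub_wspan; exists (idop K1); first exact: id_commutant.
      by exists eta => //; rewrite compop_idl.
    by exists v.
  exists (bra_slice (dil_tensor DM) xi \c dil_op DM); last by rewrite compopA.
  apply: sub_wspan; exists (idop H1); first exact: id_commutant.
  by exists xi => //; rewrite compop_idl.
rewrite /pullback [X in X `<=` _]closureE; apply: smallest_sub => // _ [S VS <-].
apply: (wspan_compop subX clX) VS => _ [v Vv [t _ <-]].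
(* Either an operator has the values of v (x) t on elementary tensors, or optens
   returns its default value 0, which lies in every subspace. *)
rewrite /optens; case: xgetP => [S' _ S'E|_]; last first.
  rewrite (_ : _ \c _ = 0); first exact: subX.1.
  by apply: op_eq => x /=; rewrite linear0.
rewrite -[adj _ \c S'](compop_idl).
apply: (wspan_compop subX clX _ (@slice_wspan _ _ _ _ _ (adj (dil_op DN) \c S'))).
move=> _ [xi _ <-]; rewrite compop_idl.
(* (v (x) t) |xi> = |t xi> v *)
have -> : adj (dil_op DN) \c S' \c adj (bra_slice (dil_tensor DM) xi) =
    adj (dil_op DN) \c adj (bra_slice (dil_tensor DN) (t xi)) \c v.
  by apply: op_eq => h /=; rewrite !adj_bra_sliceE S'E.
exact: rank1.
Qed.

(** The nested closed spans of the right hand side are removed one after the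
    other, each by checking membership on generators; the span inside
    [qrel_adj] is reached through the adjoint, which is conjugate linear and weak* continuous. *)
Lemma sub_pullback :
  qrel_comp (qrel_comp (qrel_adj (cp_qrel DN)) V) (cp_qrel DM) `<=`
  pullback DM DN V.
Proof.
set Y := pullback _ _ _.
have subY : subspace_set Y := pullback_subspace.
have clY : closed Y by exact: closed_closure.
have [_ _ VB] := qV.
apply: wspan_min => // _ [s Vs [b Wb <-]].
rewrite -(compop_idl s).
apply: (wspan_compop subY clY _ Vs) => _ [_ [n Wn <-] [v Vv <-]].
rewrite compop_idl -[_ \c b]compop_idr.
apply: (wspan_compop subY clY _ Wb) => _ [x Mx [xi _ <-]].
rewrite compop_idr; set Z := _ \c dil_op DM.
have -> : adj n \c v \c Z = idop K2 \c adj n \c (v \c Z).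
  by rewrite compop_idl compopA.
move: n Wn; apply: wspan_min => [||_ [y Ny [eta _ <-]]].
- split=> [|a n n' Yn Yn'] /=.
    rewrite (_ : _ \c _ = 0); first exact: subY.1.
    have -> : adj (0 : bounded_op K2 K1) = 0.
      by apply: adj_eq => p q; rewrite inner0r inner0l.
    by apply: op_eq.
  by rewrite adj_lin compop_linear; exact: subY.2.
- have ca := @adj_continuous R K2 K1.
  have cc := @compop_continuous R _ _ _ _ (idop K2) (v \c Z).
  have /continuous_closedP/(_ Y clY) :
      continuous (fun n => idop K2 \c adj n \c (v \c Z)).
    by move=> n; exact: continuous_comp (ca n) (cc (adj n)).
  exact.
(* Here the bimodule property absorbs x and y into V, and what remains is
   v (x) |eta><xi| with the new v. *)
have Vyvx : V (adj y \c v \c x) by apply: VB => //; exact: commutant_adj Ny.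
have [t tE] := optens_rank1 (dil_tensor DM) (dil_tensor DN)
  (adj y \c v \c x) xi eta.
apply: subset_closure.
exists (optens (dil_tensor DM) (dil_tensor DN) (adj y \c v \c x) t).
  by apply: sub_wspan; exists (adj y \c v \c x) => //; exists t.
by rewrite tE !adj_comp; exact: op_eq.
Qed.
End Pullback.

Theorem proposition4p15 (R : realType) (H1 H2 K1 K2 : hilbertType R)
    (M1 : set (bounded_op H1 H1)) (M2 : set (bounded_op H2 H2))
    (N1 : set (bounded_op K1 K1)) (N2 : set (bounded_op K2 K2))
    (vN_M1 : von_neumann_algebra M1) (vN_M2 : von_neumann_algebra M2)
    (vN_N1 : von_neumann_algebra N1) (vN_N2 : von_neumann_algebra N2)
    (V : set (bounded_op H1 K1)) (qV : quantum_relation M1 N1 V)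
    (thetaM : bounded_op H1 H1 -> bounded_op H2 H2)
    (thetaN : bounded_op K1 K1 -> bounded_op K2 K2)
    (cpM : normal_cp M1 M2 thetaM) (cpN : normal_cp N1 N2 thetaN)
    (DM DM' : dilation M1 thetaM) (DN DN' : dilation N1 thetaN) :
  pullback DM DN V
  = qrel_comp (qrel_comp (qrel_adj (cp_qrel DN')) V) (cp_qrel DM').
Proof.
have -> : cp_qrel DM' = cp_qrel DM.
  by apply/seteqP; split; exact: cp_qrel_sub.
have -> : cp_qrel DN' = cp_qrel DN.
  by apply/seteqP; split; exact: cp_qrel_sub.
by apply/seteqP; split; [exact: pullback_sub|exact: sub_pullback].
Qed.
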